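(* Let $P$ be a monic prime in $A = \mathbb{F}_q[T]$, let $\alpha \in \mathbb{F}_q^{\times}$, and set $M_P := \alpha C_P(1)$. Let $K_P = k(\Lambda_P)$ be the $P$-th cyclotomic function field, $\lambda_P$ a primitive $P$-th root of $C_P$, and $\mathcal{O}_P$ the ring of integers of $K_P$ (the integral closure of $A$ in $K_P$). Then $M_P$ is a prime in $A$ if and only if $1 - \lambda_P$ is a prime element of $\mathcal{O}_P$. Furthermore, when $M_P$ is a prime, the prime ideal $M_P A$ splits completely in $K_P$.
   Context: $q$ is a power of a prime, $A = \mathbb{F}_q[T]$, $k = \mathbb{F}_q(T)$, and $\bar k$ is a fixed algebraic closure of $k$. The Carlitz module is the unique $\mathbb{F}_q$-algebra homomorphism $a \mapsto C_a$ from $A$ to the ring of $\mathbb{F}_q$-linear polynomials in $A[x]$ (composition as multiplication) with $C_T(x) = Tx + x^q$; $C_a(1)$ is the value of $C_a(x)$ at $x=1$. For nonzero $m \in A$, $\Lambda_m = \{\lambda \in \bar k : C_m(\lambda) = 0\}$, which is an $A$-module via $a \cdot \lambda = C_a(\lambda)$; for $m$ of positive degree, a primitive $m$-th root of $C_m$ is an element $\lambda_m \in \Lambda_m$ generating $\Lambda_m$ as an $A$-module, and $K_m = k(\Lambda_m)$ is the $m$-th cyclotomic function field. *)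

(* Defs.v *)
From HB Require Import structures.
From mathcomp Require Import all_boot all_order all_fingroup all_algebra.
From mathcomp Require Import all_solvable all_field.
From mathcomp Require Import boolp classical_sets.

Set Implicit Arguments.
Unset Strict Implicit.
Unset Printing Implicit Defensive.

Import GRing.Theory.
Local Open Scope ring_scope.

(* A = F_q[T] is {poly F} with T = 'X, and A[x] is {poly {poly F}} with x = 'X,
   where q = #|F|; every prime power is the order of some finite field F. *)

Definition Fq_linear (F : finFieldType) (f : {poly {poly F}}) : Prop :=
  forall i, f`_i != 0 -> exists j, i = (#|F| ^ j)%N.

Record is_carlitz_module (F : finFieldType)
    (C : {poly F} -> {poly {poly F}}) : Prop := IsCarlitzModule {
  carlitz_module_Fq_linear : forall a, Fq_linear (C a);
  carlitz_moduleD : forall a b, C (a + b) = C a + C b;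
  carlitz_moduleZ : forall (c : F) a, C (c *: a) = c%:P *: C a;
  carlitz_module1 : C 1 = 'X;
  carlitz_moduleM : forall a b, C (a * b) = C a \Po C b;
  carlitz_moduleX : C 'X = 'X *: 'X + 'X^#|F|
}.

Definition carlitzT (F : finFieldType) : {poly {poly F}} :=
  'X *: 'X + 'X^#|F|.

(* carlitzP below shows that this is the one map that satisfies
   is_carlitz_module. *)
Definition carlitz (F : finFieldType) (a : {poly F}) : {poly {poly F}} :=
  \sum_(i < size a) (a`_i)%:P *: iter i (fun f => carlitzT F \Po f) 'X.

Lemma carlitzE (F : finFieldType) (n : nat) (a : {poly F}) :
  (size a <= n)%N ->
  carlitz a =
  \sum_(i < n) (a`_i)%:P *: iter i (fun f => carlitzT F \Po f) 'X.
Proof.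
move=> le_an; rewrite /carlitz.
rewrite (big_ord_widen n (fun i => (a`_i)%:P *: iter i _ 'X)) // big_mkcond.
apply: eq_bigr => i _; case: ltnP => // le_ai.
by rewrite nth_default // polyC0 scale0r.
Qed.

Lemma Fq_pnat (F : finFieldType) (j : nat) :
  [pchar {poly {poly F}}].-nat (#|F| ^ j)%N.
Proof.
have [p p_pr pF] := finPcharP F; rewrite pnatX; apply/orP; left.
have: p.-nat #|F|.
  have := abelem_pgroup (fin_ring_pchar_abelem pF).
  by rewrite /pgroup cardsT.
apply: sub_in_pnat => l _; rewrite !inE => /eqP->.
by move: pF; rewrite -2!(pchar_poly _ p) inE.
Qed.

Lemma Fq_expf (F : finFieldType) (c : F) (j : nat) : c ^+ (#|F| ^ j) = c.
Proof. by elim: j => [|j IHj]; rewrite ?expr1 // expnS exprM expf_card. Qed.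

Lemma Fq_linear_sum (F : finFieldType) (I : finType)
    (f : I -> {poly {poly F}}) :
  (forall i, Fq_linear (f i)) -> Fq_linear (\sum_i f i).
Proof.
move=> lin_f j; rewrite coef_sum => nz.
have [/existsP[i]|/existsPn z] := boolP [exists i, (f i)`_j != 0].
  exact: lin_f.
by case/eqP: nz; apply: big1 => i _; apply/eqP/negPn/z.
Qed.

Lemma Fq_linearZ (F : finFieldType) (c : {poly F}) (f : {poly {poly F}}) :
  Fq_linear f -> Fq_linear (c *: f).
Proof.
move=> lin_f i; rewrite coefZ => nz; apply: lin_f; apply: contraNneq nz => ->.
by rewrite mulr0.
Qed.

Lemma Fq_linearXn (F : finFieldType) (j : nat) :
  Fq_linear ('X^(#|F| ^ j) : {poly {poly F}}).
Proof.
by move=> i; rewrite coefXn; have [-> _|_] := eqVneq i (#|F| ^ j)%N; [exists j | rewrite eqxx].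
Qed.

Lemma Fq_linear_carlitzT (F : finFieldType) : Fq_linear (carlitzT F).
Proof.
have lX := Fq_linearZ (c := 'X) (@Fq_linearXn F 0); have lXq := @Fq_linearXn F 1.
move=> i; have [z|/lX //] := eqVneq (('X *: 'X : {poly {poly F}})`_i) 0.
by rewrite /carlitzT coefD z add0r => nz; apply: lXq; rewrite expn1.
Qed.

Lemma Fq_linear_compD (F : finFieldType) (f g h : {poly {poly F}}) :
  Fq_linear f -> f \Po (g + h) = (f \Po g) + (f \Po h).
Proof.
move=> lin_f; rewrite !comp_polyE -big_split /=; apply: eq_bigr => i _.
have [->|/lin_f[j ->]] := eqVneq f`_i 0; first by rewrite !scale0r addr0.
by rewrite exprDn_pchar ?Fq_pnat // scalerDr.
Qed.

Lemma Fq_linear_comp0 (F : finFieldType) (f : {poly {poly F}}) :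
  Fq_linear f -> f \Po 0 = 0.
Proof.
by move=> lf; apply: (@addrI _ (f \Po 0)); rewrite -Fq_linear_compD // !addr0.
Qed.

Lemma Fq_linear_comp_sum (F : finFieldType) (I : finType)
    (f : {poly {poly F}}) (g : I -> {poly {poly F}}) :
  Fq_linear f -> f \Po (\sum_i g i) = \sum_i (f \Po g i).
Proof.
move=> lf; apply: (big_morph (fun h => f \Po h)) => [g1 g2|].
  exact: Fq_linear_compD.
exact: Fq_linear_comp0.
Qed.

Lemma Fq_linear_compZ (F : finFieldType) (c : F) (f g : {poly {poly F}}) :
  Fq_linear f -> f \Po (c%:P *: g) = c%:P *: (f \Po g).
Proof.
move=> lin_f; rewrite !comp_polyE scaler_sumr; apply: eq_bigr => i _.
have [->|/lin_f[j ->]] := eqVneq f`_i 0; first by rewrite !scale0r scaler0.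
by rewrite exprZn -rmorphXn /= Fq_expf !scalerA mulrC.
Qed.

Lemma Fq_linear_exp (F : finFieldType) (j : nat) (f : {poly {poly F}}) :
  Fq_linear f -> Fq_linear (f ^+ (#|F| ^ j)).
Proof.
move=> lin_f; rewrite -[f]coefK poly_def.
rewrite (big_morph (fun h => h ^+ (#|F| ^ j)) (id1 := 0) (op1 := +%R)).
- apply: Fq_linear_sum => i; rewrite exprZn.
  have [->|/lin_f[l ->]] := eqVneq f`_i 0.
    by rewrite expr0n expn_eq0 -leqn0 leqNgt (ltnW (finNzRing_gt1 F)) scale0r => l;
      rewrite coef0 eqxx.
  by rewrite -exprM -expnD; apply/Fq_linearZ/Fq_linearXn.
- by move=> g h; rewrite exprDn_pchar ?Fq_pnat.
by rewrite expr0n expn_eq0 -leqn0 leqNgt (ltnW (finNzRing_gt1 F)).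
Qed.

Lemma Fq_linear_comp (F : finFieldType) (f g : {poly {poly F}}) :
  Fq_linear f -> Fq_linear g -> Fq_linear (f \Po g).
Proof.
move=> lin_f lin_g; rewrite comp_polyE; apply: Fq_linear_sum => i.
have [->|/lin_f[j ->]] := eqVneq f`_i 0.
  by rewrite scale0r => l; rewrite coef0 eqxx.
exact/Fq_linearZ/Fq_linear_exp.
Qed.

Lemma carlitzD (F : finFieldType) (a b : {poly F}) :
  carlitz (a + b) = carlitz a + carlitz b.
Proof.
have le_ab := size_polyD a b; set n := maxn _ _ in le_ab.
rewrite (carlitzE le_ab) (carlitzE (leq_maxl _ _ : _ <= n)%N).
rewrite (carlitzE (leq_maxr _ _ : _ <= n)%N) -big_split /=.
by apply: eq_bigr => i _; rewrite coefD polyCD scalerDl.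
Qed.

Lemma carlitzZ (F : finFieldType) (c : F) (a : {poly F}) :
  carlitz (c *: a) = c%:P *: carlitz a.
Proof.
rewrite (carlitzE (size_scale_leq c a)) scaler_sumr.
by apply: eq_bigr => i _; rewrite coefZ polyCM scalerA.
Qed.

Lemma carlitz1 (F : finFieldType) : carlitz 1 = 'X :> {poly {poly F}}.
Proof. by rewrite /carlitz size_poly1 big_ord1 coef1 scale1r. Qed.

Lemma carlitz0 (F : finFieldType) : carlitz 0 = 0 :> {poly {poly F}}.
Proof. by rewrite /carlitz size_poly0 big_ord0. Qed.

Lemma carlitz_mulX (F : finFieldType) (a : {poly F}) :
  carlitz (a * 'X) = carlitzT F \Po carlitz a.
Proof.
have lT := @Fq_linear_carlitzT F.
have le_aX : (size (a * 'X)%R <= (size a).+1)%N.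
  by rewrite (leq_trans (size_polyMleq _ _)) // size_polyX addn2.
rewrite (carlitzE le_aX) big_ord_recl coefMX eqxx scale0r add0r.
rewrite Fq_linear_comp_sum //; apply: eq_bigr => i _.
by rewrite Fq_linear_compZ // coefMX.
Qed.

Lemma carlitzM (F : finFieldType) (a b : {poly F}) :
  carlitz (a * b) = carlitz a \Po carlitz b.
Proof.
elim/poly_ind: a => [|a c IHa]; first by rewrite mul0r carlitz0 comp_poly0.
rewrite mulrDl mul_polyC !carlitzD carlitzZ comp_polyD mulrAC !carlitz_mulX.
by rewrite IHa comp_polyA -[c%:P in RHS]alg_polyC carlitzZ carlitz1
  comp_polyZ comp_polyX.
Qed.

Lemma carlitzX (F : finFieldType) : carlitz 'X = carlitzT F.
Proof. by rewrite -['X]mul1r carlitz_mulX carlitz1 comp_polyXr. Qed.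

Lemma Fq_linear_carlitz (F : finFieldType) (a : {poly F}) :
  Fq_linear (carlitz a).
Proof.
apply: Fq_linear_sum => i; apply: Fq_linearZ; elim: (nat_of_ord i) => [|j IHj].
  exact: (@Fq_linearXn F 0).
exact: Fq_linear_comp (@Fq_linear_carlitzT F) IHj.
Qed.

Lemma carlitzP (F : finFieldType) (C : {poly F} -> {poly {poly F}}) :
  is_carlitz_module C <-> C =1 @carlitz F.
Proof.
split=> [[_ CD CZ C1 CM CX] a|eqC]; last first.
  split=> [a|a b|c a||a b|]; rewrite !eqC; [exact: Fq_linear_carlitz
    | exact: carlitzD | exact: carlitzZ | exact: carlitz1 | exact: carlitzM
    | exact: carlitzX].
have C0 : C 0 = 0 by rewrite -[X in C X](scale0r 1) CZ polyC0 scale0r.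
elim/poly_ind: a => [|a c IHa]; first by rewrite C0 carlitz0.
rewrite CD carlitzD -alg_polyC CZ carlitzZ C1 carlitz1 mulrC CM IHa CX.
by rewrite mulrC carlitz_mulX.
Qed.

Definition embA (F : finFieldType) (L : fieldType)
    (emb : {rmorphism {fraction {poly F}} -> L}) : {poly F} -> L :=
  emb \o @tofrac {poly F}.

Definition is_algebraic_closure (k : fieldType) (L : closedFieldType)
    (emb : {rmorphism k -> L}) : Prop :=
  forall x : L, algebraicOver emb x.

Local Open Scope classical_set_scope.

Section CarlitzTorsion.
Variables (F : finFieldType) (L : fieldType).
Variable emb : {rmorphism {fraction {poly F}} -> L}.

Definition carlitz_act (a : {poly F}) (x : L) : L :=
  (map_poly (embA emb) (carlitz a)).[x].

Definition carlitz_torsion (m : {poly F}) : set L :=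
  [set x | carlitz_act m x = 0].

Definition primitive_root_of_carlitz (m : {poly F}) (x : L) : Prop :=
  carlitz_torsion m x /\
  forall y, carlitz_torsion m y -> exists a, y = carlitz_act a x.

Definition cyclotomic_field (m : {poly F}) : set L :=
  smallest (fun S : set L => divring_closed [in S])
    (range emb `|` carlitz_torsion m).

Definition integral_closure_in (K : set L) : set L :=
  [set x | K x /\ integralOver (embA emb) x].

End CarlitzTorsion.

Definition extension_degree (k L : fieldType) (emb : {rmorphism k -> L})
    (K : set L) (n : nat) : Prop :=
  exists b : 'I_n -> L, (forall i, K (b i)) /\
    forall x, K x -> exists! c : 'rV[k]_n, x = \sum_i emb (c 0 i) * b i.

Section SubringIdeals.
(* O is the underlying set of a subring of L. *)
Variables (L : fieldType) (O : set L).

Definition prime_elt (x : L) : Prop :=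
  [/\ O x, x != 0, ~ (exists2 y, O y & x * y = 1) &
    forall a b, O a -> O b -> (exists2 c, O c & a * b = x * c) ->
      (exists2 c, O c & a = x * c) \/ (exists2 c, O c & b = x * c)].

Definition is_ideal (I : set L) : Prop :=
  [/\ I `<=` O, I 0, forall x y, I x -> I y -> I (x + y) &
    forall a x, O a -> I x -> I (a * x)].

Definition is_prime_ideal (I : set L) : Prop :=
  [/\ is_ideal I, ~ I 1 &
    forall a b, O a -> O b -> I (a * b) -> I a \/ I b].

Definition ideal_mul (I J : set L) : set L :=
  smallest is_ideal [set a * b | a in I & b in J].

End SubringIdeals.

Definition principal_ideal (R : comNzRingType) (x : R) : set R :=
  range ( *%R x).

(* q O_K is the product of [K : k] distinct prime ideals of O_K, where O_K is
   the integral closure of A in K. *)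
Definition splits_completely (F : finFieldType) (L : fieldType)
    (emb : {rmorphism {fraction {poly F}} -> L}) (K : set L)
    (q : set {poly F}) : Prop :=
  let O := integral_closure_in emb K in
  exists n (Q : 'I_n -> set L),
    [/\ extension_degree emb K n, injective Q,
        forall i, is_prime_ideal O (Q i) &
        smallest (is_ideal O) (embA emb @` q) =
          \big[ideal_mul O/O]_(i < n) Q i].

(* Main.v *)
Require Import Defs.
From HB Require Import structures.
From mathcomp Require Import all_boot all_order all_fingroup all_algebra.
From mathcomp Require Import all_solvable all_field.
From mathcomp Require Import boolp classical_sets.
From mathcomp Require Import ring.

(* Let [Phi(X) = C_P(X) / X], monic over [A] with [Phi(0) = P]. The roots of
   [Phi] are the nonzero [P]-torsion points; they are associates of one another
   over the integral elements, so [Phi] is irreducible over [k] by an Eisenstein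
   argument, and [C_P(1) = Phi(1)] is the product of the [1 - x], [x] a root.
   As [C_P' = P], Lagrange interpolation at the roots gives [P O <= A[lambda]].
   Hence if [a] in [A] is [(1 - lambda) c] with [c] in [O], then
   [P a - (1 - X) g(X)] vanishes at [lambda] for some [g] in [A[X]], is a
   multiple of [Phi] in [A[X]], and at [X = 1] this reads [Phi(1) | P a], so
   [Phi(1) | a] because [Phi(1)] is prime to [P]. Likewise [A] surjects onto
   [O / (1 - lambda)], which is therefore [A / C_P(1)]. The same holds at every
   root, and [C_P(1) O] is the product of the ideals [(1 - x)], pairwise
   distinct because differences of roots divide [P]. *)

Set Implicit Arguments.
Unset Strict Implicit.
Unset Printing Implicit Defensive.

Import GRing.Theory.
Local Open Scope ring_scope.

Local Notation "x %:F" := (tofrac x) : ring_scope.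

(** * Fractions over a domain, and the characteristic of a finite field *)

Lemma frac_quotient (R : idomainType) (x : {fraction R}) :
  exists a b : R, b != 0 /\ x = a%:F / b%:F.
Proof.
elim/quotW: x => r; exists \n_r, \d_r; split; first exact: denom_ratioP.
have nz: (\d_r)%:F != 0 :> {fraction R} by rewrite tofrac_eq0 denom_ratioP.
apply: (mulIf nz); rewrite divfK //.
rewrite /GRing.mul /= !piE; apply/eqmodP; rewrite /= equivfE /FracField.mulf.
by rewrite !numden_Ratio ?mulr1 ?mul1r ?oner_eq0 ?mulf_neq0 ?denom_ratioP //
  mulrC.
Qed.

Lemma frac_poly_coprime (F : fieldType) (x : {fraction {poly F}}) :
  exists a b : {poly F}, [/\ b != 0, coprimep a b & x = a%:F / b%:F].
Proof.
have [a [b [b0 ->]]] := frac_quotient x.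
have g0 : gcdp a b != 0 by rewrite gcdp_eq0 (negPf b0) andbF.
exists (a %/ gcdp a b), (b %/ gcdp a b).
have q0 : b %/ gcdp a b != 0 by rewrite dvdp_div_eq0 // dvdp_gcdr.
split=> //; first by rewrite coprimep_div_gcd // b0 orbT.
apply/eqP; rewrite eqr_div ?tofrac_eq0 // -!tofracM tofrac_eq.
by rewrite divp_mulCA ?dvdp_gcdl ?dvdp_gcdr // mulrC.
Qed.

(** Translation by 1 permutes [F], so the sum of all elements equals itself plus [#|F|] times 1. *)
Lemma natr_card_finField (F : finFieldType) : #|F|%:R = 0 :> F.
Proof.
apply: (@addrI _ (\sum_(x : F) x)); rewrite addr0.
by rewrite [RHS](reindex_inj (addIr 1)) big_split sumr_const.
Qed.

Lemma mulrn_card_poly2 (F : finFieldType) (p : {poly {poly F}}) :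
  p *+ #|F| = 0.
Proof. by rewrite -mulr_natr -!polyC_natr natr_card_finField mulr0. Qed.

(** * Coefficients and derivative of the Carlitz polynomials *)

Section Carlitz.
Variable F : finFieldType.
Implicit Types a b : {poly F}.

Lemma coef0_carlitz a : (carlitz a)`_0 = 0.
Proof.
apply/eqP; apply: contraT => /(@Fq_linear_carlitz F a)[j /esym/eqP].
by rewrite expn_eq0 -leqn0 leqNgt (ltnW (finNzRing_gt1 F)).
Qed.

Lemma carlitz_cons a (c : F) :
  carlitz (a * 'X + c%:P) =
  'X *: carlitz a + carlitz a ^+ #|F| + c%:P *: 'X.
Proof.
rewrite carlitzD carlitz_mulX -[in carlitz c%:P]alg_polyC carlitzZ carlitz1.
by rewrite /carlitzT comp_polyD comp_polyZ comp_polyX comp_Xn_poly.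
Qed.

(** In the recursion [carlitz_cons] the [q]-th power has zero derivative, because [q] is 0 in [F].
    What remains is the recursion that builds [a] itself. *)
Lemma deriv_carlitz a : (carlitz a)^`() = a%:P.
Proof.
elim/poly_ind: a => [|a c IHa].
  by rewrite carlitz0 deriv0.
rewrite carlitz_cons !derivD !derivZ derivX deriv_exp mulrn_card_poly2 addr0.
by rewrite IHa -!mul_polyC mulr1 -polyCM -polyCD mulrC.
Qed.

Lemma coef1_carlitz a : (carlitz a)`_1 = a.
Proof. by have := coef_deriv (carlitz a) 0; rewrite deriv_carlitz coefC. Qed.

(** For [a != 0] the [q]-th power in [carlitz_cons] has the largest degree, and raising to the power
    [q] fixes the leading coefficient, which lies in [F]. *)
Lemma lead_coef_carlitz a : lead_coef (carlitz a) = (lead_coef a)%:P.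
Proof.
elim/poly_ind: a => [|a c IHa]; first by rewrite carlitz0 !lead_coef0.
have [->|a0] := eqVneq a 0.
  rewrite mul0r add0r -alg_polyC carlitzZ carlitz1 -mul_polyC alg_polyC.
  by rewrite lead_coefM lead_coefX !lead_coefC mulr1.
have f0 : carlitz a != 0 by rewrite -lead_coef_eq0 IHa polyC_eq0 lead_coef_eq0.
have szf : (1 < size (carlitz a))%N.
  rewrite ltnNge; apply: contra f0 => /size1_polyC->.
  by rewrite coef0_carlitz.
have q1 := finNzRing_gt1 F.
have szq : (size (carlitz a) < size (carlitz a ^+ #|F|))%N.
  have ->: size (carlitz a ^+ #|F|) = ((size (carlitz a)).-1 * #|F|).+1.
    by rewrite -size_exp prednK // lt0n size_poly_eq0 expf_neq0.
  by case: (size _) szf => [|[|s]] // _; rewrite !ltnS ltn_Pmulr.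
rewrite carlitz_cons lead_coefDl; last first.
  rewrite addrC size_polyDl ?(leq_ltn_trans (size_scale_leq _ _)) //.
  by rewrite size_polyX (leq_ltn_trans szf).
rewrite addrC lead_coefDl ?(leq_ltn_trans (size_scale_leq _ _)) //.
rewrite lead_coef_exp IHa -polyC_exp expf_card lead_coefDl ?lead_coefMX //.
by rewrite size_mulX // (leq_ltn_trans (size_polyC_leq1 c)) // ltnS lt0n
  size_poly_eq0.
Qed.

(** This is exact division by ['X], since the constant coefficient of [carlitz a] is 0. *)
Definition carlitz_quot a : {poly {poly F}} := drop_poly 1 (carlitz a).

Lemma carlitz_quotE a : carlitz a = carlitz_quot a * 'X.
Proof.
rewrite -[LHS](poly_take_drop 1) (_ : take_poly 1 _ = 0) ?add0r //.
by apply/polyP => -[|i]; rewrite coef_take_poly coef0 // coef0_carlitz.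
Qed.

Lemma horner1_carlitz_quot a : (carlitz_quot a).[1] = (carlitz a).[1].
Proof. by rewrite carlitz_quotE hornerMX mulr1. Qed.

Lemma coef0_carlitz_quot a : (carlitz_quot a)`_0 = a.
Proof. by rewrite coef_drop_poly add0n coef1_carlitz. Qed.

Lemma monic_carlitz_quot a : a \is monic -> carlitz_quot a \is monic.
Proof.
by rewrite !monicE -(lead_coefMX (carlitz_quot a)) -carlitz_quotE lead_coef_carlitz => /eqP->.
Qed.

End Carlitz.

(** * Elements integral over [A] *)

Section Integral.
Variables (F : finFieldType) (L : fieldType).
Variable emb : {rmorphism {fraction {poly F}} -> L}.

HB.instance Definition _ :=
  GRing.RMorphism.copy (embA emb) (emb \o @tofrac {poly F}).

Local Notation Int := (integralOver (embA emb)).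
Local Notation embk := (map_poly emb).
Local Notation embAX := (map_poly (embA emb)).

Lemma embA_eq0 a : (embA emb a == 0) = (a == 0).
Proof. by rewrite /embA /= fmorph_eq0 tofrac_eq0. Qed.

Lemma map_embA p : embAX p = embk (map_poly (@tofrac _) p).
Proof. by rewrite map_poly_comp. Qed.

Lemma integral_embA a : Int (embA emb a).
Proof. exact: integral_id. Qed.

Lemma integral_prod (I : Type) (r : seq I) (P : pred I) (f : I -> L) :
  (forall i, P i -> Int (f i)) -> Int (\prod_(i <- r | P i) f i).
Proof.
by move=> Pf; elim/big_ind: _; [exact: integral1 | exact: integral_mul |].
Qed.

Lemma integral_sum (I : Type) (r : seq I) (P : pred I) (f : I -> L) :
  (forall i, P i -> Int (f i)) -> Int (\sum_(i <- r | P i) f i).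
Proof.
by move=> Pf; elim/big_ind: _; [exact: integral0 | exact: integral_add |].
Qed.

Lemma integral_hornerA (g : {poly {poly F}}) x : Int x -> Int (embAX g).[x].
Proof.
move=> Ix; apply: integral_horner => //; apply/integral_poly => i.
by rewrite coef_map; apply: integral_embA.
Qed.

Lemma integral_coef_prod_XsubC (s : seq L) :
  {in s, forall x, Int x} -> forall i, Int (\prod_(x <- s) ('X - x%:P))`_i.
Proof.
elim: s => [|x s IHs] Is i.
  by rewrite big_nil coef1; apply: integral_nat.
rewrite big_cons coefM; apply: integral_sum => j _; apply: integral_mul.
  rewrite coefB coefX coefC; apply: integral_sub; first exact: integral_nat.
  by case: ifP => _; [apply: Is; rewrite mem_head | exact: integral0].
by apply: IHs => y ys; apply: Is; rewrite inE ys orbT.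
Qed.

(** [A] is integrally closed: in lowest terms [a / b], clearing denominators in a monic equation of
    degree [m] gives that [b] divides [a ^+ m], so [b] is a unit. *)
Lemma integral_frac (x : {fraction {poly F}}) :
  Int (emb x) -> exists a, x = a%:F.
Proof.
case: (frac_poly_coprime x) => a [b [b0 cab ->]] [p mon_p].
have bF : b%:F != 0 :> {fraction {poly F}} by rewrite tofrac_eq0.
rewrite map_embA fmorph_root rootE horner_coef size_map_poly_id0; last first.
  by rewrite (monicP mon_p) tofrac1 oner_eq0.
have := monic_neq0 mon_p; rewrite -size_poly_gt0 => sz_p.
have e: size p = (size p).-1.+1 by rewrite prednK.
set m := (size p).-1 in e; rewrite e big_ord_recr /= => /eqP p0.
(* The equation [p0] multiplied by [b ^+ m], with the leading term kept apart. *)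
have {p0} : (\sum_(i < m) p`_i * a ^+ i * b ^+ (m - i) + a ^+ m)%:F = 0
    :> {fraction {poly F}}.
  rewrite -[RHS](mul0r (b%:F ^+ m)) -p0 mulrDl tofracD rmorph_sum mulr_suml.
  congr (_ + _).
    apply: eq_bigr => i _; rewrite coef_map /= !tofracM !tofracXn exprMn.
    rewrite -!mulrA; do 2!congr (_ * _).
    have ->: b%:F ^+ m = b%:F ^+ i * b%:F ^+ (m - i) :> {fraction {poly F}}.
      by rewrite -exprD subnKC // ltnW.
    by rewrite exprVn mulKf ?expf_neq0.
  rewrite coef_map -/m -(lead_coefE) (monicP mon_p) mul1r.
  by rewrite exprMn exprVn mulfVK ?expf_neq0 // tofracXn.
move/eqP; rewrite tofrac_eq0 addrC addr_eq0 => /eqP am.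
have: b %| a ^+ m.
  rewrite am dvdpNr; elim/big_ind: _ => [|u v|i _].
  - exact: dvdp0.
  - by move=> bu bv; rewrite dvdp_addr.
  by rewrite -(subnSK (ltn_ord i)) exprS dvdp_mull // dvdp_mulr.
have := coprimep_expl m cab; rewrite coprimep_sym => /Gauss_dvdpl cb.
rewrite -[a ^+ m]mul1r cb dvdp1 => /size_poly1P[c c0 eb].
exists (c^-1 *: a); rewrite eb in bF *; apply: (mulIf bF).
by rewrite divfK // -tofracM mulrC mul_polyC scalerA divff // scale1r.
Qed.

(** For [a != 0] the cofactor [w] is the fraction [b / a]; being integral, it lies in [A]. This
    brings divisibility among integral elements back to [A]. *)
Lemma embA_dvdp a b w : Int w -> embA emb a * w = embA emb b -> a %| b.
Proof.
have [->|a0] := eqVneq a 0 => Iw.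
  by rewrite rmorph0 mul0r => /esym/eqP; rewrite embA_eq0 dvd0p.
move=> e; have ew : w = emb (b%:F / a%:F).
  have aL : embA emb a != 0 by rewrite embA_eq0.
  by apply: (mulfI aL); rewrite e rmorphM fmorphV mulrC mulfVK.
have [c ec] : exists c, b%:F / a%:F = c%:F.
  by apply: integral_frac; rewrite -ew.
have: b%:F = (c * a)%:F :> {fraction {poly F}}.
  by rewrite tofracM -ec mulfVK // tofrac_eq0.
by move/eqP; rewrite tofrac_eq => /eqP ->; rewrite dvdp_mulIr.
Qed.

End Integral.

(** * The Carlitz action on the field [L] *)

Section CarlitzAction.
Variables (F : finFieldType) (L : fieldType).
Variable emb : {rmorphism {fraction {poly F}} -> L}.

Local Notation act := (carlitz_act emb).
Local Notation embAX := (map_poly (embA emb)).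

Lemma carlitz_actM a b x : act (a * b) x = act a (act b x).
Proof. by rewrite /carlitz_act carlitzM map_comp_poly horner_comp. Qed.

Lemma carlitz_actD a b x : act (a + b) x = act a x + act b x.
Proof. by rewrite /carlitz_act carlitzD rmorphD hornerD. Qed.

Lemma carlitz_act1 x : act 1 x = x.
Proof. by rewrite /carlitz_act carlitz1 map_polyX hornerX. Qed.

Lemma carlitz_actE a x : act a x = x * (embAX (carlitz_quot a)).[x].
Proof.
by rewrite /carlitz_act carlitz_quotE rmorphM /= map_polyX hornerMX mulrC.
Qed.

Lemma carlitz_actr0 a : act a 0 = 0.
Proof. by rewrite carlitz_actE mul0r. Qed.

Lemma carlitz_actB a b x : act (a - b) x = act a x - act b x.
Proof. by apply/eqP; rewrite eq_sym subr_eq -carlitz_actD subrK. Qed.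

Lemma separable_carlitz (a : {poly F}) :
  a != 0 -> separable_poly (embAX (carlitz a)).
Proof.
move=> a0; rewrite unlock deriv_map deriv_carlitz map_polyC /=.
by rewrite -[_%:P]alg_polyC coprimepZr ?coprimep1 // embA_eq0.
Qed.

(** The torsion module is cyclic over the field [A / P], so any nonzero element generates it. *)
Lemma primitive_root_gen (P : {poly F}) x y :
    irreducible_poly P -> primitive_root_of_carlitz emb P x ->
    act P y = 0 -> y != 0 ->
  primitive_root_of_carlitz emb P y.
Proof.
move=> irrP [Px genx] Py y0; split=> // z /genx[a ->].
have [b yE] := genx y Py.
have: coprimep P b.
  rewrite irreducible_poly_coprime //; apply: contra y0 => /dvdpP[c cE].
  by rewrite yE cE carlitz_actM Px carlitz_actr0.
case/Bezout_eq1_coprimepP => -[u v] /= uv.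
(* [v] inverts [b] modulo [P], so that [act v y = x]. *)
exists (a * v); rewrite yE -carlitz_actM -mulrA carlitz_actM; congr (act a _).
rewrite -[LHS]carlitz_act1 -uv carlitz_actD (carlitz_actM u) Px carlitz_actr0.
by rewrite add0r.
Qed.

End CarlitzAction.

(** * Principal ideals of a subring and their products *)

Section Ideals.
Local Open Scope classical_set_scope.
Variables (L : fieldType) (O : set L).
Hypotheses (O1 : O 1) (OB : forall u v, O u -> O v -> O (u - v)).
Hypothesis OM : forall u v, O u -> O v -> O (u * v).

Lemma ideal_pid x : O x -> is_ideal O [set x * c | c in O].
Proof.
move=> Ox; have O0 : O 0 by rewrite -(subrr 1); apply: OB.
split=> [_ [c Oc <-]||_ _ [c Oc <-] [d Od <-]|a _ Oa [c Oc <-]].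
- exact: OM.
- by exists 0 => //; rewrite mulr0.
- exists (c - (0 - d)); first by do 2!apply: (OB) => //.
  by rewrite sub0r opprK mulrDr.
by exists (a * c); [apply: OM | rewrite mulrCA].
Qed.

Lemma ideal_mul_pid x y : O x -> O y ->
  ideal_mul O [set x * c | c in O] [set y * c | c in O]
    = [set x * y * c | c in O].
Proof.
move=> Ox Oy; apply/seteqP; split=> [|_ [c Oc <-] I [[_ _ _ IM] subI]].
  apply: smallest_sub; first by apply: ideal_pid; apply: OM.
  move=> _ [_ [c Oc <-] [_ [d Od <-] <-]].
  by exists (c * d); [apply: OM | rewrite mulrACA].
(* An ideal containing all the products contains [x * y], hence its multiples. *)
rewrite mulrC; apply: IM => //; apply: subI.
by exists x; [exists 1 | exists y; [exists 1 | ]]; rewrite ?mulr1.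
Qed.

Lemma big_ideal_mul_pid n (x : 'I_n -> L) : (forall i, O (x i)) ->
  \big[ideal_mul O/O]_(i < n) [set x i * c | c in O]
    = [set (\prod_(i < n) x i) * c | c in O].
Proof.
(* The invariant also records that the generator lies in [O], as [ideal_mul_pid] requires. The empty
   product [O] is generated by 1. *)
move=> Ox; pose R (I : set L) y := I = [set y * c | c in O] /\ O y.
suff [] : R (\big[ideal_mul O/O]_(i < n) [set x i * c | c in O])
            (\prod_(i < n) x i) by [].
apply: (big_ind2 R) => [|_ a _ b [-> Oa] [-> Ob]|//].
  split=> //; apply/seteqP; split=> [c Oc|_ [c Oc <-]]; last by rewrite mul1r.
  by exists c => //; rewrite mul1r.
by split; [rewrite ideal_mul_pid | apply: OM].
Qed.

Lemma prime_ideal_pid x :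
  prime_elt O x -> is_prime_ideal O [set x * c | c in O].
Proof.
move=> [Ox _ nu pr]; split=> [|[c Oc cE]|a b Oa Ob [c Oc cE]].
- exact: ideal_pid.
- by apply: nu; exists c.
have [|[d Od ->]|[d Od ->]] := pr a b Oa Ob; first by exists c.
  by left; exists d.
by right; exists d.
Qed.

End Ideals.

(** * The roots [rs] of [Phi], that is, the nonzero [P]-torsion points *)

Section PrimeConductor.
Variables (F : finFieldType) (L : fieldType).
Variable emb : {rmorphism {fraction {poly F}} -> L}.

Local Notation act := (carlitz_act emb).
Local Notation Int := (integralOver (embA emb)).
Local Notation embk := (map_poly emb).
Local Notation embAX := (map_poly (embA emb)).

Variable P : {poly F}.
Hypotheses (monP : P \is monic) (irrP : irreducible_poly P).

Local Notation Phi := (carlitz_quot P).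
Local Notation Phik := (map_poly (@tofrac _) Phi).

Variable rs : seq L.
Hypothesis uniq_rs : uniq rs.
Hypothesis PhiE : embAX Phi = \prod_(x <- rs) ('X - x%:P).
Hypothesis prim_rs : {in rs, forall x, primitive_root_of_carlitz emb P x}.

Let monPhi : Phi \is monic. Proof. exact: monic_carlitz_quot. Qed.

Lemma P_neq0 : P != 0. Proof. exact: monic_neq0. Qed.

Lemma rs_neq0 x : x \in rs -> x != 0.
Proof.
move=> xs; apply: contraTneq xs => ->.
rewrite -root_prod_XsubC -PhiE rootE horner_coef0 coef_map /=.
by rewrite coef0_carlitz_quot embA_eq0 P_neq0.
Qed.

Lemma mem_rs x : (x \in rs) = (act P x == 0) && (x != 0).
Proof.
have [xs|] := boolP (x \in rs).
  by rewrite rs_neq0 // andbT; have [Px _] := prim_rs xs; apply/esym/eqP.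
rewrite -root_prod_XsubC -PhiE rootE carlitz_actE mulf_eq0 => /negPf ->.
by rewrite orbF andbN.
Qed.

Lemma integral_rs x : x \in rs -> Int x.
Proof. by exists Phi => //; rewrite PhiE root_prod_XsubC. Qed.

(** [y] is some [act a x], and the polynomial [carlitz a] is divisible by ['X]. Exchanging [x] and
    [y] shows that the two are associates. *)
Lemma rs_associate x y :
  x \in rs -> y \in rs -> exists2 w, Int w & y = x * w.
Proof.
move=> xs ys; have [_ genx] := prim_rs xs; have [Py _] := prim_rs ys.
have [a ->] := genx y Py; rewrite carlitz_actE.
exists (embAX (carlitz_quot a)).[x] => //.
exact/integral_hornerA/integral_rs.
Qed.

Lemma prod_opp_rs : \prod_(x <- rs) (- x) = embA emb P.
Proof.
rewrite -[in RHS](coef0_carlitz_quot P) -coef_map PhiE -horner_coef0.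
by rewrite horner_prod; apply: eq_bigr => x _; rewrite !hornerE.
Qed.

Lemma prod_one_sub_rs : \prod_(x <- rs) (1 - x) = embA emb (Phi.[1]).
Proof.
transitivity (embAX Phi).[1]; last by rewrite -horner_map rmorph1.
by rewrite PhiE horner_prod; apply: eq_bigr => x _; rewrite !hornerE.
Qed.

Lemma size_rs_gt0 : (0 < size rs)%N.
Proof.
rewrite lt0n size_eq0; apply: contraTneq irrP.1 => rs0.
have := prod_opp_rs; rewrite rs0 big_nil -(rmorph1 (embA emb)) => /eqP.
rewrite -subr_eq0 -rmorphB embA_eq0 subr_eq0 => /eqP <-.
by rewrite size_poly1.
Qed.

Lemma mem_head_rs : head 0 rs \in rs.
Proof. by case: (rs) size_rs_gt0 => // x s _; rewrite mem_head. Qed.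

(** If one root were a unit among the integral elements, all its associates would be, and so would
    their product [P] up to signs. Then [P] would be a unit of [A]. *)
Lemma rs_not_unit x w : x \in rs -> Int w -> x * w != 1.
Proof.
move=> xs Iw; apply/eqP => xw.
suff [v Iv]: exists2 v, Int v & embA emb P * v = 1.
  rewrite -(rmorph1 (embA emb)) => /(embA_dvdp Iv); rewrite dvdp1.
  by rewrite gtn_eqF // irrP.1.
rewrite -prod_opp_rs big_seq.
elim/big_ind: _ => [|a b [a' Ia aE] [b' Ib bE]|y ys].
- by exists 1; [exact: integral1 | rewrite mulr1].
- by exists (a' * b'); [exact: integral_mul | rewrite mulrACA aE bE mulr1].
have [u Iu xE] := rs_associate ys xs.
exists (- (u * w)); first exact/integral_opp/integral_mul.
by rewrite mulrNN mulrA -xE.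
Qed.

(** Up to sign the constant coefficient is the product of the roots in [s], hence integral, and it
    lies in [k], hence in [A]. If it is a unit of [A], no root can occur in [s]. *)
Lemma factor_constant_coef (u : {poly {fraction {poly F}}}) (s : seq L) :
    {subset s <= rs} -> embk u = \prod_(x <- s) ('X - x%:P) ->
  exists2 a, u`_0 = a%:F & size a = 1%N -> size u = 1%N.
Proof.
move=> srs uE; have u0 : emb u`_0 = \prod_(x <- s) (- x).
  rewrite -coef_map uE -horner_coef0 horner_prod.
  by apply: eq_bigr => x _; rewrite !hornerE.
have [a ua] : exists a, u`_0 = a%:F.
  apply: (integral_frac (emb := emb)); rewrite u0 big_seq.
  apply: integral_prod => x xs.
  exact/integral_opp/integral_rs/srs.
exists a => // /eqP/size_poly1P[c c0 aE].
rewrite -(size_map_poly emb) uE size_prod_XsubC.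
case: s srs uE u0 => [//|x s] srs uE.
rewrite big_cons ua aE => eq_c; have xs: x \in rs by apply/srs/mem_head.
(* This would be an integral inverse of [x]: the constant coefficient [c] is [- x] times the product
   over [s]. *)
have: Int ((- \prod_(y <- s) (- y)) * embA emb c^-1%:P).
  apply: integral_mul (integral_embA _ _); apply: integral_opp.
  rewrite big_seq; apply: integral_prod => y ys.
  by apply/integral_opp/integral_rs/srs; rewrite inE ys orbT.
move/(rs_not_unit xs); rewrite mulrA mulrN -mulNr -eq_c -rmorphM /=.
by rewrite -tofracM -polyCM divff // tofrac1 rmorph1 eqxx.
Qed.

(* Eisenstein's criterion at [P]: the constant terms of two nontrivial monic
   factors of [Phi] are products of associates of a nonunit, while their
   product is the prime [P]. *)
Lemma irreducible_Phik : irreducible_poly Phik.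
Proof.
have mon_k : Phik \is monic by apply: monic_map; apply: monPhi.
have szPhi : size Phik = (size rs).+1.
  by rewrite -(size_map_poly emb) -map_embA PhiE size_prod_XsubC.
split=> [|q szq dvq]; first by rewrite szPhi ltnS size_rs_gt0.
wlog mon_q : q szq dvq / q \is monic.
  have q0 : lead_coef q != 0.
    rewrite lead_coef_eq0; apply: contraTneq dvq => ->.
    by rewrite dvd0p monic_neq0.
  move/(_ ((lead_coef q)^-1 *: q)); rewrite size_scale ?invr_eq0 // => H.
  have eq_q: (lead_coef q)^-1 *: q %= q by apply: eqp_scale; rewrite invr_eq0.
  apply: eqp_trans (H szq _ _); first by rewrite eqp_sym.
    by rewrite (eqp_dvdl _ eq_q).
  by apply/monicP; rewrite lead_coefZ; apply: mulVf.
have /dvdpP[h hE] := dvq.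
have mon_h : h \is monic by have := mon_k; rewrite hE monicMr.
have split_of u : u \is monic -> u %| Phik ->
    exists2 a, u`_0 = a%:F & size a = 1%N -> size u = 1%N.
  move=> mon_u; rewrite -(dvdp_map emb) -map_embA PhiE.
  case/dvdp_prod_XsubC => m; rewrite eqp_monic ?map_monic ?monic_prod_XsubC //.
  by move/eqP/factor_constant_coef; apply; apply: mem_subseq (mask_subseq _ _).
have [a qa a1] := split_of q mon_q dvq.
have [|b hb b1] := split_of h mon_h; first by rewrite hE dvdp_mulr.
have PE : P = b * a.
  apply/eqP; rewrite -tofrac_eq; apply/eqP.
  rewrite tofracM -qa -hb -coef0M -hE coef_map /=.
  by rewrite coef0_carlitz_quot.
have [/a1/eqP|sza] := eqVneq (size a) 1%N; first by rewrite (negPf szq).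
have /eqpP[[c d] /= /andP[c0 d0] cd] : a %= P.
  by apply: irrP.2 => //; rewrite PE dvdp_mull.
have szb : size b = 1%N.
  have : size a = size P by rewrite -(size_scale a c0) cd size_scale.
  rewrite PE size_mul; last 2 first.
  - by apply: contra_neq P_neq0 => b0; rewrite PE b0 mul0r.
  - by apply: contra_neq P_neq0 => a0; rewrite PE a0 mulr0.
  have: (0 < size a)%N.
    rewrite size_poly_gt0; apply: contra_neq P_neq0 => a0.
    by rewrite PE a0 mulr0.
  case: (size a) => // n _; rewrite addnS /= => /eqP.
  by rewrite -[n.+1]add1n eqn_add2r => /eqP.
have /eqP/size_poly1P[e e0 he] := b1 szb.
rewrite hE he mul_polyC eqp_sym; exact: eqp_scale e0.
Qed.

(** The gcd of [Phik] and [f] vanishes at [x], so it is not constant, and by irreducibility it is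
    associated to [Phik]. *)
Lemma root_rs_dvdp x (f : {poly {fraction {poly F}}}) :
  x \in rs -> root (embk f) x -> Phik %| f.
Proof.
move=> xs fx; have gP := dvdp_gcdl Phik f.
rewrite -(eqp_dvdl _ (irreducible_Phik.2 _ _ gP)) ?dvdp_gcdr //.
rewrite -(size_map_poly emb) gcdp_map neq_ltn; apply/orP; right.
apply: (@root_size_gt1 _ x).
  by rewrite gcdp_eq0 negb_and -map_embA PhiE monic_neq0 ?monic_prod_XsubC.
by rewrite root_gcd fx -map_embA PhiE root_prod_XsubC xs.
Qed.

Lemma dvdp_root_rs x (f : {poly {fraction {poly F}}}) :
  x \in rs -> Phik %| f -> (embk f).[x] = 0.
Proof.
move=> xs; rewrite -(dvdp_map emb) -map_embA PhiE => /dvdpP[g ->].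
by apply/eqP; rewrite -[_ == 0]/(root _ x) rootM root_prod_XsubC xs orbT.
Qed.

(** If the monic [p] annihilates [f(x)], then [p] composed with [f] is a multiple of [Phik]. The
    same [p] therefore annihilates [f(y)]. *)
Lemma integral_conj x y (f : {poly {fraction {poly F}}}) :
  x \in rs -> y \in rs -> Int (embk f).[x] -> Int (embk f).[y].
Proof.
move=> xs ys [p mon_p pfx]; exists p => //.
have map_f z : (embAX p).[(embk f).[z]]
             = (embk (map_poly (@tofrac _) p \Po f)).[z].
  by rewrite map_embA map_comp_poly horner_comp.
rewrite rootE map_f (dvdp_root_rs ys) //; apply: root_rs_dvdp (xs) _.
by rewrite rootE -map_f.
Qed.

Lemma size_Phik : size Phik = (size rs).+1.
Proof. by rewrite -(size_map_poly emb) -map_embA PhiE size_prod_XsubC. Qed.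

(** * Lagrange interpolation at the roots *)

Let cof y := \prod_(z <- rem y rs) ('X - z%:P).

(** Differentiate [C_P = Phi * 'X] and evaluate at [y]: the left side is [P], and on the right only
    [y * Phi'(y)] survives, where [Phi'(y)] is the value of the cofactor. *)
Lemma cof_self y : y \in rs -> y * (cof y).[y] = embA emb P.
Proof.
move=> ys; have := deriv_carlitz P => /(congr1 embAX).
rewrite -deriv_map map_polyC /= carlitz_quotE rmorphM /= map_polyX PhiE.
rewrite (big_rem y) //= -/(cof y) => /(congr1 (horner^~ y)).
by rewrite /= !derivE !hornerE subrr !mul0r !addr0 mulrC.
Qed.

Lemma cof_other y z : z \in rs -> z != y -> (cof y).[z] = 0.
Proof.
move=> zs zy; apply/eqP; rewrite -[_ == 0]/(root _ z) root_prod_XsubC.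
by rewrite mem_rem_uniq // inE zy.
Qed.

(* Lagrange interpolation: [P * f] and [sum_y f(y) y cof_y] agree on [rs]
   since [y * (cof y).[y] = P], and the latter has integral coefficients. *)
Lemma mulP_integral x (f : {poly {fraction {poly F}}}) :
    x \in rs -> Int (embk f).[x] ->
  exists g, embA emb P * (embk f).[x] = (embAX g).[x].
Proof.
move=> xs Ifx; pose r := (P%:F *: f) %% Phik.
have r_rs y : y \in rs -> (embk r).[y] = embA emb P * (embk f).[y].
  move=> ys; have := divp_eq (P%:F *: f) Phik.
  move/(congr1 (fun h => (embk h).[y])).
  rewrite /= map_polyZ hornerZ /= => ->; rewrite rmorphD hornerD /=.
  by rewrite (dvdp_root_rs ys (dvdp_mulIr _ Phik)) add0r.
pose G := \sum_(y <- rs) ((embk f).[y] * y) *: cof y.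
(* Both polynomials have size at most [size rs] and agree at the [size rs] distinct roots; reduction
   modulo [Phik] keeps these values and bounds the size. *)
have rG : embk r = G.
  apply/eqP; rewrite -subr_eq0; apply/eqP.
  apply: (@roots_geq_poly_eq0 _ _ rs) (uniq_rs) _.
    apply/allP => y ys; rewrite /= rootE hornerD hornerN r_rs // subr_eq0.
    rewrite horner_sum (bigD1_seq y) //= hornerZ -mulrA cof_self // mulrC.
    rewrite big_seq_cond big1 ?addr0 // => z /andP[zs zy].
    by rewrite hornerZ cof_other ?mulr0 // eq_sym.
  rewrite (leq_trans (size_polyD _ _)) // size_polyN geq_max size_map_poly.
  have Phik0 : Phik != 0 by rewrite -size_poly_gt0 size_Phik.
  rewrite -ltnS -size_Phik ltn_modp Phik0 /= /G big_seq.
  elim/big_ind: _ => [|u v su sv|y ys]; first by rewrite size_poly0.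
    by rewrite (leq_trans (size_polyD _ _)) // geq_max su.
  rewrite (leq_trans (size_scale_leq _ _)) // size_prod_XsubC size_rem //.
  by rewrite prednK // size_rs_gt0.
have Ir i : exists a, r`_i = a%:F.
  apply: (integral_frac (emb := emb)); rewrite -coef_map rG coef_sum big_seq.
  apply: integral_sum => y ys; rewrite coefZ; apply: integral_mul.
    by apply: integral_mul (integral_rs ys); apply: integral_conj Ifx.
  by apply: integral_coef_prod_XsubC => z /mem_rem; apply: integral_rs.
have [a aE] := choice Ir; exists (\poly_(i < size r) a i).
rewrite -r_rs // map_embA; congr (map_poly _ _).[_]; apply/polyP => i.
by rewrite coef_map coef_poly; case: ltnP => [_|?] /=; [rewrite aE | rewrite tofrac0 nth_default].
Qed.

(** Division by the monic [Phi] can be done over [A], which keeps the quotient in [A[X]]. The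
    remainder vanishes at [x], so it is a multiple of [Phik] of smaller size, hence 0. *)
Lemma root_rs_factor x g : x \in rs -> root (embAX g) x -> exists h, g = h * Phi.
Proof.
move=> xs gx; have gE := Pdiv.RingMonic.rdivp_eq monPhi g.
exists (Pdiv.CommonRing.rdivp g Phi); rewrite {1}gE.
set r := Pdiv.CommonRing.rmodp g Phi in gE *; suff -> : r = 0 by rewrite addr0.
have size_tofrac p : size (map_poly (@tofrac {poly F}) p) = size p.
  rewrite size_map_inj_poly ?tofrac0 // => u v /eqP.
  by rewrite tofrac_eq => /eqP.
have: Phik %| map_poly (@tofrac _) r.
  apply: root_rs_dvdp (xs) _; rewrite -map_embA; move: gx; rewrite gE rmorphD.
  rewrite rmorphM /= PhiE !rootE hornerD hornerM.
  suff -> : (\prod_(z <- rs) ('X - z%:P)).[x] = 0 by rewrite mulr0 add0r.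
  by apply/eqP; rewrite -[_ == 0]/(root _ x) root_prod_XsubC.
move=> dv; apply/eqP; rewrite -size_poly_eq0 -size_tofrac size_poly_eq0.
apply: contraTT dv => r0; apply/negP => /(dvdp_leq r0).
by rewrite !size_tofrac leqNgt Pdiv.CommonRing.ltn_rmodpN0 // monic_neq0.
Qed.

(** Fix a root [x]. Every root is a multiple of [x], so [Phi(1)] is congruent to 1 modulo [x], while
    [P] is congruent to 0. If [P] divided [Phi(1)], then [x] would be a unit. *)
Lemma coprime_P_Phi1 : coprimep P Phi.[1].
Proof.
rewrite irreducible_poly_coprime //; apply/negP => /dvdpP[h hE].
have xs := mem_head_rs; set x := head 0 rs in xs.
have [w Iw wE] : exists2 w, Int w & \prod_(z <- rs) (1 - z) = 1 + x * w.
  rewrite big_seq; elim/big_ind: _ => [|a b [u Iu ->] [v Iv ->]|y ys].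
  - by exists 0; [exact: integral0 | rewrite mulr0 addr0].
  - exists (u + v + u * (x * v)); last by rewrite !mulrDr !mulrDl; ring.
    apply: integral_add; first exact: integral_add.
    by do 2![apply: integral_mul => //]; apply: integral_rs.
  have [u Iu ->] := rs_associate xs ys.
  by exists (- u); [exact: integral_opp | rewrite mulrN].
have [v Iv vE] : exists2 v, Int v & embA emb P = x * v.
  exists (- \prod_(z <- rem x rs) (- z)); last first.
    by rewrite -prod_opp_rs (big_rem x) //= mulrN mulNr.
  apply: integral_opp; rewrite big_seq; apply: integral_prod => z /mem_rem zs.
  exact/integral_opp/integral_rs.
have Ih : Int (v * embA emb h - w).
  by apply: integral_sub => //; apply: integral_mul (integral_embA _ _).
have /eqP[] := rs_not_unit xs Ih.
rewrite mulrBr mulrA -vE -rmorphM /= mulrC -hE -prod_one_sub_rs wE.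
by rewrite addrK.
Qed.

Lemma one_sub_dvd x a (f : {poly {fraction {poly F}}}) :
    x \in rs -> Int (embk f).[x] -> embA emb a = (1 - x) * (embk f).[x] ->
  Phi.[1] %| a.
Proof.
move=> xs Ifx aE; have [g gE] := mulP_integral xs Ifx.
have [|h hE] := @root_rs_factor x ((P * a)%:P - (1%:P - 'X) * g) xs.
  rewrite rootE rmorphB /= map_polyC /= hornerD hornerN hornerC rmorphM /=.
  rewrite rmorphM /= rmorphB /= map_polyC map_polyX hornerM -gE aE.
  by rewrite hornerD hornerN hornerC hornerX /= rmorph1 mulrCA subrr.
rewrite -(@Gauss_dvdpr _ _ P) 1?coprimep_sym ?coprime_P_Phi1 //.
have := congr1 (horner^~ 1) hE.
by rewrite /= !hornerE subrr mul0r subr0 => ->; rewrite dvdp_mulIr.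
Qed.

(** * The field [K], generated by any single root, and its ring of integers [O] *)

Local Notation K := (cyclotomic_field emb P).
Local Notation O := (integral_closure_in emb K).
Local Open Scope classical_set_scope.

(** All torsion points are polynomials in [x], and [k[x]] is already a field because [Phik] is
    irreducible. The root [x] is left arbitrary so that each root can serve as generator. *)
Lemma cyclotomic_fieldP x y : x \in rs ->
  K y <-> exists f, y = (embk f).[x].
Proof.
move=> xs; have [Px genx] := prim_rs xs; split; last first.
  move=> [f ->] S /= [[S1 SB SV] subS].
  have {}S1 : S 1 by move: S1; rewrite inE.
  have {}SB u v : S u -> S v -> S (u - v).
    by move=> Su Sv; have := SB u v; rewrite !inE; apply.
  have {}SV u v : S u -> S v -> S (u / v).
    by move=> Su Sv; have := SV u v; rewrite !inE; apply.
  have SD u v : S u -> S v -> S (u + v).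
    move=> Su Sv; rewrite -[v]opprK; apply: (SB) => //.
    by rewrite -sub0r -(subrr 1); apply: (SB) => //; apply: SB.
  have SM u v : S u -> S v -> S (u * v).
    by move=> Su Sv; rewrite -[v]invrK; apply: (SV) => //; rewrite -div1r; apply: SV.
  elim/poly_ind: f => [|p c IHp].
    by rewrite rmorph0 horner0 -(subrr 1); apply: SB.
  rewrite rmorphD rmorphM /= map_polyX map_polyC /= hornerMXaddC.
  apply: SD; last by apply: subS; left; exists c.
  by apply: SM => //; apply: subS; right.
move: y; apply: (@smallest_sub _ _ _ [set z | exists f, z = (embk f).[x]]).
  split=> [|u v|u v]; rewrite !inE.
  - by exists 1; rewrite rmorph1 hornerC.
  - by move=> [f ->] [g ->]; exists (f - g); rewrite rmorphB hornerD hornerN.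
  (* Division is total, with the inverse of 0 equal to 0, so a zero divisor is treated apart.
     Otherwise the Bezout coefficient [b] of [g] modulo [Phik] gives the inverse. *)
  move=> [f ->] [g ->]; have [g0|gx0] := eqVneq (embk g).[x] 0.
    by exists 0; rewrite g0 invr0 mulr0 rmorph0 horner0.
  have: coprimep Phik g.
    rewrite irreducible_poly_coprime; last exact: irreducible_Phik.
    by apply: contra gx0 => /(dvdp_root_rs xs) ->.
  case/Bezout_eq1_coprimepP => -[a b] /= ab; exists (f * b).
  rewrite rmorphM hornerM; congr (_ * _); apply: (mulIf gx0).
  rewrite mulVf //; have := congr1 (fun h => (embk h).[x]) ab.
  rewrite /= rmorphD rmorphM rmorph1 /= hornerD hornerC => <-.
  rewrite hornerM (dvdp_root_rs xs (dvdpp _)) mulr0 add0r.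
  by rewrite rmorphM hornerM.
move=> z [[c _ <-]|/genx[a ->]].
- by exists c%:P; rewrite map_polyC hornerC.
- by exists (map_poly (@tofrac _) (carlitz a)); rewrite -map_embA.
Qed.

Lemma ringO x y : x \in rs ->
  O y <-> exists2 f, y = (embk f).[x] & Int y.
Proof.
move=> xs; split=> [[/(cyclotomic_fieldP _ xs)[f fE] Iy]|[f fE Iy]].
  by exists f.
by split=> //; apply/(cyclotomic_fieldP _ xs); exists f.
Qed.

Let x0 := head 0 rs.
Let x0_rs : x0 \in rs := mem_head_rs.

Lemma ringO_embA a : O (embA emb a).
Proof.
apply/(ringO _ x0_rs); exists (a%:F)%:P; last exact: integral_embA.
by rewrite map_polyC hornerC.
Qed.

Lemma ringO1 : O 1.
Proof. by rewrite -(rmorph1 (embA emb)); apply: ringO_embA. Qed.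

Lemma ringO0 : O 0.
Proof. by rewrite -(rmorph0 (embA emb)); apply: ringO_embA. Qed.

Lemma ringOB u v : O u -> O v -> O (u - v).
Proof.
move=> /(ringO _ x0_rs)[f fE Iu] /(ringO _ x0_rs)[g gE Iv]; apply/(ringO _ x0_rs).
exists (f - g); last exact: integral_sub.
by rewrite fE gE rmorphB hornerD hornerN.
Qed.

Lemma ringON u : O u -> O (- u).
Proof. by move=> Ou; rewrite -sub0r; apply: ringOB => //; apply: ringO0. Qed.

Lemma ringOD u v : O u -> O v -> O (u + v).
Proof. by move=> Ou /ringON Ov; rewrite -[v]opprK; apply: ringOB. Qed.

Lemma ringOM u v : O u -> O v -> O (u * v).
Proof.
move=> /(ringO _ x0_rs)[f fE Iu] /(ringO _ x0_rs)[g gE Iv]; apply/(ringO _ x0_rs).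
by exists (f * g); [rewrite fE gE rmorphM hornerM | apply: integral_mul].
Qed.

Lemma ringO_rs x : x \in rs -> O x.
Proof.
move=> xs; apply/(ringO _ xs); exists 'X; last exact: integral_rs.
by rewrite map_polyX hornerX.
Qed.

Lemma ringO_one_sub x : x \in rs -> O (1 - x).
Proof. by move=> xs; apply: ringOB ringO1 (ringO_rs xs). Qed.

Lemma ringO_hornerA g x : x \in rs -> O (embAX g).[x].
Proof.
move=> xs; apply/(ringO _ xs); exists (map_poly (@tofrac _) g).
  by rewrite -map_embA.
exact/integral_hornerA/integral_rs.
Qed.

(** * Residues modulo [1 - x] *)

Lemma one_sub_dvd_Phi1 x : x \in rs ->
  exists2 c, O c & embA emb Phi.[1] = (1 - x) * c.
Proof.
move=> xs; exists (\prod_(z <- rem x rs) (1 - z)).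
  rewrite big_seq; elim/big_ind: _ => [||z /mem_rem].
  - exact: ringO1.
  - exact: ringOM.
  exact: ringO_one_sub.
by rewrite -prod_one_sub_rs (big_rem x).
Qed.

Lemma one_sub_dvdA x a : x \in rs ->
  (exists2 c, O c & embA emb a = (1 - x) * c) <-> Phi.[1] %| a.
Proof.
move=> xs; split=> [[c /(ringO _ xs)[f -> Ic]]|/dvdpP[h ->]].
  exact: one_sub_dvd.
have [c Oc cE] := one_sub_dvd_Phi1 xs.
exists (embA emb h * c); first by apply: ringOM Oc; apply: ringO_embA.
by rewrite rmorphM /= cE mulrCA.
Qed.

(** [P * y] equals some [g(x)], which is congruent to [g(1)] in [A]. As [P] is invertible modulo
    [Phi(1)], it is invertible modulo [1 - x], and [y] is congruent to [u * g(1)], where [u] is the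
    inverse of [P]. *)
Lemma residue_one_sub x y : x \in rs -> O y ->
  exists a, exists2 c, O c & y = embA emb a + (1 - x) * c.
Proof.
move=> xs Oy; have [f fE Iy] := (ringO _ xs).1 Oy; rewrite fE in Iy.
have [g gE] := mulP_integral xs Iy; rewrite -fE in gE.
have [[u v] /= uv] := Bezout_eq1_coprimepP _ _ coprime_P_Phi1.
have [t Ot tE] := one_sub_dvd_Phi1 xs.
have /factor_theorem[s sE] : root (g - g.[1]%:P) 1.
  by rewrite rootE !hornerE subrr.
exists (u * g.[1]), (embA emb v * t * y - embA emb u * (embAX s).[x]).
  apply: ringOB; do ?apply: ringOM => //; try exact: ringO_embA.
  exact: ringO_hornerA.
have gx : (embAX g).[x] = embA emb g.[1] - (1 - x) * (embAX s).[x].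
  have -> : g = s * ('X - 1%:P) + g.[1]%:P by rewrite -sE subrK.
  rewrite rmorphD rmorphM /= rmorphB /= map_polyX !map_polyC !hornerE /=.
  by rewrite rmorph1 subrr mulr0 add0r; ring.
have yE : y = embA emb u * (embA emb P * y) + embA emb v * embA emb Phi.[1] * y.
  by rewrite mulrA -mulrDl -!rmorphM -rmorphD uv rmorph1 mul1r.
by rewrite [LHS]yE gE gx tE rmorphM /=; ring.
Qed.

Lemma prime_elt_one_sub x : x \in rs ->
  irreducible_poly Phi.[1] -> prime_elt O (1 - x).
Proof.
move=> xs irr1; have nd1 : ~ exists2 y, O y & (1 - x) * y = 1.
  move=> [y Oy yE]; have: Phi.[1] %| 1.
    by apply/(one_sub_dvdA _ xs); exists y => //; rewrite rmorph1 yE.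
  by rewrite dvdp1 gtn_eqF // irr1.1.
split=> // [||a b Oa Ob [c Oc abE]].
- exact: ringO_one_sub.
- apply/eqP => x1; have [c _] := one_sub_dvd_Phi1 xs.
  rewrite x1 mul0r => /eqP; rewrite embA_eq0 => /eqP phi0.
  by have := irr1.1; rewrite phi0 size_poly0.
have [a' [ca Oca aE]] := residue_one_sub xs Oa.
have [b' [cb Ocb bE]] := residue_one_sub xs Ob.
(* [a * b] and [a' * b'] are congruent modulo [1 - x], so divisibility passes to the representatives
   in [A], where [Phi(1)] is prime. *)
have: Phi.[1] %| a' * b'.
  apply/(one_sub_dvdA _ xs).
  exists (c - ca * b - embA emb a' * cb); last first.
    by rewrite rmorphM /= !mulrBr -abE aE bE; ring.
  apply: ringOB; last by apply: ringOM => //; apply: ringO_embA.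
  by apply: ringOB => //; apply: ringOM.
have lift d d' cd : O cd -> d = embA emb d' + (1 - x) * cd -> Phi.[1] %| d' ->
    exists2 e, O e & d = (1 - x) * e.
  move=> Ocd dE /(one_sub_dvdA _ xs)[e Oe eE].
  by exists (e + cd); [exact: ringOD | rewrite mulrDr -eE].
have [da _|nda] := boolP (Phi.[1] %| a'); first by left; apply: lift aE da.
rewrite Gauss_dvdpr ?irreducible_poly_coprime // => db.
by right; apply: lift bE db.
Qed.

(** In a factorisation of [Phi(1)] in [A], the prime [1 - x] divides one factor. By [one_sub_dvdA]
    so does [Phi(1)], and the other factor is a unit. *)
Lemma irreducible_of_prime_elt x : x \in rs ->
  prime_elt O (1 - x) -> irreducible_poly Phi.[1].
Proof.
(* If [Phi(1)] were 0, then 1 would be a root, [Phik] would divide ['X - 1], and every root, in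
   particular [x], would equal 1. *)
move=> xs [_ x1 nd1 pr]; have phi0 : Phi.[1] != 0.
  apply: contraNneq x1 => phi0; have := prod_one_sub_rs.
  rewrite phi0 rmorph0 => /eqP; rewrite prodf_seq_eq0 => /hasP[z zs] /=.
  rewrite subr_eq0 => /eqP z1.
  have: Phik %| 'X - 1%:P.
    by apply: root_rs_dvdp (zs) _; rewrite map_polyXsubC rmorph1 root_XsubC -z1.
  move/(dvdp_root_rs xs); rewrite map_polyXsubC rmorph1 hornerXsubC => /eqP.
  by rewrite -oppr_eq0 opprB.
have [t Ot tE] := one_sub_dvd_Phi1 xs.
split=> [|q szq /dvdpP[b bE]].
  (* If [Phi(1)] were a nonzero constant, its divisor [1 - x] would be a unit. *)
  rewrite ltnNge; apply/negP => /size1_polyC phiC; apply: nd1.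
  exists (t * embA emb (Phi.[1]`_0)^-1%:P).
    by apply: ringOM => //; apply: ringO_embA.
  rewrite mulrA -tE -rmorphM /= {1}phiC -polyCM divff ?rmorph1 //.
  by apply: contraNneq phi0 => c0; rewrite phiC c0.
have [|/(one_sub_dvdA _ xs)|/(one_sub_dvdA _ xs)] :=
    pr _ _ (ringO_embA b) (ringO_embA q).
- by exists t => //; rewrite -tE bE rmorphM.
- move/dvdpP => [c cE]; case/negP: szq.
  have b0 : b != 0 by apply: contraNneq phi0 => b0; rewrite bE b0 mul0r.
  rewrite -dvdp1; apply/dvdpP; exists c; apply: (mulfI b0).
  by rewrite mulr1 mulrCA -bE.
by move=> dq; rewrite /eqp dq andbT bE dvdp_mulIr.
Qed.

(** * The degree of [K] over [k] and complete splitting *)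

Lemma extension_degree_cyclotomic : extension_degree emb K (size rs).
Proof.
have horner_rV (c : 'rV[{fraction {poly F}}]_(size rs)) :
    (embk (rVpoly c)).[x0] = \sum_i emb (c 0 i) * x0 ^+ i.
  rewrite (@horner_coef_wide _ (size rs)) ?size_map_poly ?size_poly //.
  by apply: eq_bigr => i _; rewrite coef_map coef_rVpoly_ord.
(* The powers of one root form a basis: coordinates are the coefficients of the remainder modulo
   [Phik], and they are unique because [Phik] divides every relation. *)
exists (fun i => x0 ^+ i); split=> [i|y /(cyclotomic_fieldP _ x0_rs)[f ->]].
  apply/(cyclotomic_fieldP _ x0_rs); exists 'X^i.
  by rewrite map_polyXn hornerXn.
have szPhik (c : 'rV[{fraction {poly F}}]_(size rs)) :
    (size (rVpoly c) < size Phik)%N.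
  by rewrite size_Phik ltnS size_poly.
have Phik0 : Phik != 0 by rewrite -size_poly_gt0 size_Phik.
exists (poly_rV (f %% Phik)); split=> [|c cE].
  rewrite -horner_rV poly_rV_K; last by rewrite -ltnS -size_Phik ltn_modp.
  rewrite [in LHS](divp_eq f Phik) rmorphD hornerD /=.
  by rewrite (dvdp_root_rs x0_rs (dvdp_mulIr _ _)) add0r.
have: Phik %| f - rVpoly c.
  apply: root_rs_dvdp (x0_rs) _.
  by rewrite rootE rmorphB hornerD hornerN /= horner_rV cE subrr.
move=> dv; rewrite -[RHS]rVpolyK; congr poly_rV.
rewrite -(modp_small (szPhik c)); apply/eqP; rewrite -subr_eq0 -modpN -modpD.
exact/eqP/modp_eq0P.
Qed.

Lemma prime_ideal_one_sub x : x \in rs -> irreducible_poly Phi.[1] ->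
  is_prime_ideal O [set (1 - x) * c | c in O].
Proof.
move=> xs /(prime_elt_one_sub xs) pr1.
apply: prime_ideal_pid pr1; [exact: ringO1 | exact: ringOB | exact: ringOM].
Qed.

(** If the ideals agree, [1 - x] divides [x - y]. A nonzero difference is again a torsion point,
    hence a root and a divisor of [P], so [Phi(1)] would divide [P], against coprimality. *)
Lemma one_sub_ideal_inj x y : x \in rs -> y \in rs ->
    irreducible_poly Phi.[1] ->
    [set (1 - x) * c | c in O] = [set (1 - y) * c | c in O] ->
  x = y.
Proof.
move=> xs ys irr1 /seteqP[_ /(_ (1 - y))[]].
  by exists 1; [exact: ringO1 | rewrite mulr1].
move=> c Oc cE; apply/eqP; rewrite -subr_eq0; apply/negPn/negP => xy0.
have xy_rs : x - y \in rs.
  have [[Px genx] [Py _]] := (prim_rs xs, prim_rs ys).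
  have [a yE] := genx y Py; rewrite mem_rs xy0 andbT.
  have -> : x - y = act (1 - a) x by rewrite carlitz_actB carlitz_act1 -yE.
  by rewrite -carlitz_actM mulrC carlitz_actM Px carlitz_actr0.
have: Phi.[1] %| P.
  apply/(one_sub_dvdA _ xs).
  (* From [cE], the factor [- (x - y)] of [P] equals [(1 - x) * (1 - c)]; the other factors come
     from the remaining roots. *)
  exists ((1 - c) * \prod_(z <- rem (x - y) rs) (- z)).
    apply: ringOM; first by apply: ringOB => //; exact: ringO1.
    rewrite big_seq; elim/big_ind: _ => [||z /mem_rem zs].
    - exact: ringO1.
    - exact: ringOM.
    exact/ringON/ringO_rs.
  rewrite -prod_opp_rs (big_rem _ xy_rs) /= mulrA; congr (_ * _).
  by rewrite mulrBr mulr1 cE; ring.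
have := coprime_P_Phi1; rewrite coprimep_sym irreducible_poly_coprime //.
by move/negP.
Qed.

Lemma splits_completely_Phi1 : irreducible_poly Phi.[1] ->
  splits_completely emb K (principal_ideal Phi.[1]).
Proof.
move=> irr1; have [O1 OB OM] := And3 ringO1 ringOB ringOM.
have nth_rs (i : 'I_(size rs)) : rs`_i \in rs by exact: mem_nth.
exists (size rs), (fun i => [set (1 - rs`_i) * c | c in O]); split.
- exact: extension_degree_cyclotomic.
- move=> i j /(one_sub_ideal_inj (nth_rs i) (nth_rs j) irr1) ij.
  by apply/val_inj/eqP; rewrite -(nth_uniq 0 _ _ uniq_rs) ?ltn_ord // ij.
- by move=> i; apply: prime_ideal_one_sub.
rewrite big_ideal_mul_pid //; last by move=> i; apply: ringO_one_sub.
have -> : \prod_(i < size rs) (1 - rs`_i) = embA emb Phi.[1].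
  by rewrite -prod_one_sub_rs (big_nth 0) big_mkord.
apply/seteqP; split=> [|z [c Oc <-] I [idI subI]].
  apply: smallest_sub; first by apply: ideal_pid => //; apply: ringO_embA.
  move=> _ [_ [b _ <-] <-]; exists (embA emb b); first exact: ringO_embA.
  by rewrite rmorphM.
have [_ _ _ IM] := idI; rewrite mulrC; apply: IM => //; apply: subI.
by exists Phi.[1] => //; exists 1 => //; rewrite mulr1.
Qed.

End PrimeConductor.

(** * Passage to an algebraically closed field and to the associate [M] of [C_P(1)] *)

Lemma eqp_irreducible (R : idomainType) (p q : {poly R}) :
  p %= q -> irreducible_poly p -> irreducible_poly q.
Proof.
move=> pq [szp irr]; split=> [|d szd dq]; first by rewrite -(eqp_size pq).
by apply: eqp_trans (pq); apply: irr => //; rewrite (eqp_dvdr _ pq).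
Qed.

(** [Phi] splits over a closed field, and its roots are distinct because it divides the separable
    polynomial [C_P]. *)
Lemma carlitz_quot_roots (F : finFieldType) (L : closedFieldType)
    (emb : {rmorphism {fraction {poly F}} -> L}) (P : {poly F}) :
    P \is monic ->
  exists2 rs : seq L, uniq rs &
    map_poly (embA emb) (carlitz_quot P) = \prod_(x <- rs) ('X - x%:P).
Proof.
move=> monP;
have [rs] :=
  closed_field_poly_normal (map_poly (embA emb) (carlitz_quot P)).
rewrite (monicP (monic_map _ (monic_carlitz_quot monP))) scale1r => rsE.
exists rs => //; rewrite -separable_prod_XsubC -rsE.
have := separable_carlitz emb (monic_neq0 monP).
by rewrite carlitz_quotE rmorphM /= separable_mul => /and3P[].
Qed.

Theorem theorem5p1 (F : finFieldType) (kbar : closedFieldType)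
    (emb : {rmorphism {fraction {poly F}} -> kbar})
    (kbar_closure : is_algebraic_closure emb)
    (P : {poly F}) (P_monic : P \is monic) (P_prime : irreducible_poly P)
    (alpha : F) (alpha_neq0 : alpha != 0)
    (lambda : kbar) (lambda_prim : primitive_root_of_carlitz emb P lambda) :
  let M := alpha *: (carlitz P).[1] in
  let K := cyclotomic_field emb P in
  let O := integral_closure_in emb K in
  (irreducible_poly M <-> prime_elt O (1 - lambda)) /\
  (irreducible_poly M -> splits_completely emb K (principal_ideal M)).
Proof.
move=> M K O; have [rs uniq_rs rsE] := carlitz_quot_roots emb P_monic.
have prim_rs : {in rs, forall x, primitive_root_of_carlitz emb P x}.
  move=> x; rewrite -root_prod_XsubC -rsE => /rootP xr.
  apply: primitive_root_gen (P_prime) lambda_prim _ _.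
    by rewrite carlitz_actE xr mulr0.
  apply: contraTneq (monic_neq0 P_monic) => x0; move: xr.
  rewrite x0 horner_coef0 coef_map /= coef0_carlitz_quot => /eqP.
  by rewrite embA_eq0 negbK.
(* A zero [lambda] would generate only 0, whereas [rs] contains a nonzero torsion point. *)
have lambda_rs : lambda \in rs.
  rewrite (mem_rs P_monic rsE prim_rs); have [Pl genl] := lambda_prim.
  rewrite (introT eqP Pl); apply/eqP => l0.
  have xs := mem_head_rs P_prime rsE.
  have [Px _] := prim_rs _ xs; have [a xE] := genl _ Px.
  have := rs_neq0 P_monic rsE xs.
  by rewrite xE l0 carlitz_actr0 eqxx.
pose N := (carlitz_quot P).[1].
have MN : M = alpha *: N by rewrite /N horner1_carlitz_quot.
have eqMN : M %= N by rewrite MN; apply: eqp_scale.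
have irrMN : irreducible_poly M <-> irreducible_poly N.
  by split; apply: eqp_irreducible => //; rewrite eqp_sym.
split; last first.
  rewrite irrMN => irrN.
  have -> : principal_ideal M = principal_ideal N.
    apply/seteqP; split=> _ [b _ <-]; rewrite MN.
      by exists (alpha *: b) => //; rewrite -scalerAr scalerAl.
    exists (alpha^-1 *: b) => //.
    by rewrite -scalerAr -scalerAl scalerA mulVf // scale1r.
  exact: splits_completely_Phi1 uniq_rs rsE prim_rs irrN.
rewrite irrMN; split.
  exact: (prime_elt_one_sub P_monic P_prime uniq_rs rsE prim_rs).
exact: (irreducible_of_prime_elt P_monic P_prime uniq_rs rsE prim_rs).
Qed.
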